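(* Let $G$ be a simple graph and let $e=v_iv_j$ be an edge of $G$ such that $v_j$ is non-pendent (degree at least $2$). If either (i) $\min\left\{\dfrac{d_i}{d_{\max}^{(i)}},\dfrac{d_j}{d_{\max}^{(j)}}\right\}>1$, or (ii) $\dfrac{d_{\max}^{(i)}-d_i+1}{2\sqrt{d_{\max}^{(i)}}\sqrt{d_i}}+\dfrac{d_{\max}^{(j)}-d_j+1}{2\sqrt{d_{\max}^{(j)}}\sqrt{d_j}}\le \dfrac{d_i+d_j}{\sqrt{d_id_j}}$, then $AG(G)>AG(G-e)$. Here, when $v_i$ is a pendent vertex, $d_i/d_{\max}^{(i)}$ is interpreted as $+\infty$ and $\frac{d_{\max}^{(i)}-d_i+1}{2\sqrt{d_{\max}^{(i)}}\sqrt{d_i}}$ is interpreted as $0$.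
   Context: $d_k$ denotes the degree of vertex $v_k$ in $G$, and $N(v)$ the neighbourhood of $v$; a pendent vertex has degree $1$. For the edge $v_iv_j$: $d_{\max}^{(j)}=\max\{d_k : v_k\in N(v_j)\setminus\{v_i\}\}$ and, when $v_i$ is non-pendent, $d_{\max}^{(i)}=\max\{d_k : v_k\in N(v_i)\setminus\{v_j\}\}$ (degrees in $G$). The arithmetic-geometric index is $AG(H)=\sum_{uv\in E(H)}\frac12\left(\sqrt{d_H(u)/d_H(v)}+\sqrt{d_H(v)/d_H(u)}\right)$, degrees taken in $H$; $G-e$ is $G$ with $e$ deleted. *)

(* Defs.v *)
From mathcomp Require Import all_boot all_order all_algebra.
From mathcomp Require Import constructive_ereal reals.

Set Implicit Arguments.
Unset Strict Implicit.
Unset Printing Implicit Defensive.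

Import Order.TTheory GRing.Theory Num.Theory.

Local Open Scope ring_scope.

Record sgraph := SGraph {
  vertex :> finType;
  adj : rel vertex;
  adj_sym : symmetric adj;
  adj_irrefl : irreflexive adj }.

Definition nbhd (G : sgraph) (v : G) : {set G} := [set u | adj v u].

Definition deg (G : sgraph) (v : G) : nat := #|nbhd v|.

Definition pendent (G : sgraph) (v : G) : bool := deg v == 1%N.

Definition edges (G : sgraph) : {set {set G}} :=
  [set [set p.1; p.2] | p : G * G & adj p.1 p.2].

Section DeleteEdge.
Variables (G : sgraph) (e : {set G}).

Definition del_adj : rel G := fun x y => adj x y && ([set x; y] != e).

Lemma del_adj_sym : symmetric del_adj.
Proof. by move=> x y; rewrite /del_adj adj_sym setUC. Qed.

Lemma del_adj_irrefl : irreflexive del_adj.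
Proof. by move=> x; rewrite /del_adj adj_irrefl. Qed.

Definition del_edge : sgraph := SGraph del_adj_sym del_adj_irrefl.

End DeleteEdge.

(* The double sum runs over the two orderings of the endpoints of the edge f,
   see AG_weightE. *)
Definition AG_weight (R : realType) (G : sgraph) (f : {set G}) : R :=
  2^-1 * \sum_(u in f) \sum_(v in f :\ u) Num.sqrt ((deg u)%:R / (deg v)%:R).

Lemma AG_weightE (R : realType) (G : sgraph) (u v : G) : adj u v ->
  AG_weight R [set u; v] =
  2^-1 * (Num.sqrt ((deg u)%:R / (deg v)%:R)
          + Num.sqrt ((deg v)%:R / (deg u)%:R)).
Proof.
move=> uv; have nuv : u != v.
  by apply/eqP => E; rewrite E adj_irrefl in uv.
rewrite /AG_weight big_setU1 ?inE //= big_set1; congr (_ * (_ + _)).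
  rewrite (_ : [set u; v] :\ u = [set v]) ?big_set1 //.
  by rewrite setU1K // inE.
rewrite (_ : [set u; v] :\ v = [set u]) ?big_set1 //.
by rewrite setUC setU1K // inE eq_sym.
Qed.

Definition AG (R : realType) (G : sgraph) : R :=
  \sum_(f in edges G) AG_weight R f.

(* For an edge vw, the maximal degree over N(v) \ {w}.  This set is nonempty
   exactly when v is not pendent; the value 0 for a pendent v is not used. *)
Definition dmax (G : sgraph) (v w : G) : nat :=
  \max_(k in nbhd v :\ w) deg k.

Definition deg_ratio (R : realType) (G : sgraph) (v w : G) : \bar R :=
  if pendent v then +oo%E else ((deg v)%:R / (dmax v w)%:R)%:E.

Definition deg_defect (R : realType) (G : sgraph) (v w : G) : R :=
  if pendent v then 0 else
  ((dmax v w)%:R - (deg v)%:R + 1)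
  / (2 * Num.sqrt (dmax v w)%:R * Num.sqrt (deg v)%:R).

(* Main.v *)
(** Deleting [e = ij] removes the weight [f(d_i, d_j)], where
    [f(x, y) = (x + y) / (2 sqrt (x y))], and replaces [f(d_v, d_k)] by
    [f(d_v - 1, d_k)] for each other neighbour [k] of an endpoint [v].  The
    increment [f(d - 1, y) - f(d, y)] is increasing in [y], so the total
    increment at a non-pendent [v] is at most [d_v - 1] times its value at
    [y = d_max], which is less than half of the defect appearing in (ii).
    Condition (i) makes both defects nonpositive, so it implies (ii); and (ii)
    says that the half defects add up to at most [f(d_i, d_j)]. *)

Require Import Defs.
From mathcomp Require Import all_boot all_order all_algebra.
From mathcomp Require Import constructive_ereal reals.
From mathcomp Require Import ring lra.

Set Implicit Arguments.
Unset Strict Implicit.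

Import Order.TTheory GRing.Theory Num.Theory.

Local Open Scope ring_scope.

(** * Edge weight as a function of two degrees, and its increments *)

Definition ag_mean (R : realType) (a b : nat) : R :=
  2^-1 * (Num.sqrt (a%:R / b%:R) + Num.sqrt (b%:R / a%:R)).

Lemma ag_meanC (R : realType) (a b : nat) : ag_mean R a b = ag_mean R b a.
Proof. by rewrite /ag_mean addrC. Qed.

Lemma sqrt_div (R : realType) (a b : nat) :
  Num.sqrt (a%:R / b%:R) = Num.sqrt a%:R / Num.sqrt b%:R :> R.
Proof. by rewrite sqrtrM ?ler0n // sqrtrV ?ler0n. Qed.

(** The factor [2^-1] stays outside so that the other factor is literally the right-hand side of
    (ii). *)
Lemma ag_mean_half (R : realType) (a b : nat) : (0 < a)%N -> (0 < b)%N ->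
  ag_mean R a b = 2^-1 * ((a%:R + b%:R) / Num.sqrt (a%:R * b%:R)).
Proof.
move=> a0 b0; rewrite /ag_mean !sqrt_div sqrtrM ?ler0n //.
set x := Num.sqrt a%:R; set y := Num.sqrt b%:R.
have hx : 0 < x by rewrite sqrtr_gt0 ltr0n.
have hy : 0 < y by rewrite sqrtr_gt0 ltr0n.
have -> : a%:R = x ^+ 2 by rewrite sqr_sqrtr ?ler0n.
have -> : b%:R = y ^+ 2 by rewrite sqr_sqrtr ?ler0n.
by field; rewrite !gt_eqF.
Qed.

(** The increment when an endpoint drops from degree [d.+1] to [d]; indexing by the smaller degree
    makes the factor [d] in [ag_step_defect] the number of remaining neighbours. *)
Definition ag_step (R : realType) (d y : nat) : R :=
  ag_mean R d y - ag_mean R d.+1 y.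

(** In this factored form [y] enters only through [c], and the bracket is visibly increasing in
    [c]. *)
Lemma ag_stepE (R : realType) (d y : nat) : (0 < d)%N -> (0 < y)%N ->
  let a := Num.sqrt d%:R in let b := Num.sqrt d.+1%:R in
  let c := Num.sqrt y%:R in
  ag_step R d y = (b - a) / 2 * (c / (a * b) - c^-1).
Proof.
move=> d0 y0 a b c; rewrite /ag_step /ag_mean !sqrt_div -/a -/b -/c.
have ha : 0 < a by rewrite sqrtr_gt0 ltr0n.
have hb : 0 < b by rewrite sqrtr_gt0 ltr0n.
have hc : 0 < c by rewrite sqrtr_gt0 ltr0n.
by field; rewrite !gt_eqF.
Qed.

Lemma ag_step_le (R : realType) (d y m : nat) :
  (0 < d)%N -> (0 < y)%N -> (y <= m)%N -> ag_step R d y <= ag_step R d m.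
Proof.
move=> d0 y0 ym; have m0 := leq_trans y0 ym.
rewrite !ag_stepE //.
have ha : 0 < Num.sqrt d%:R :> R by rewrite sqrtr_gt0 ltr0n.
have hb : 0 < Num.sqrt d.+1%:R :> R by rewrite sqrtr_gt0 ltr0n.
have hc : 0 < Num.sqrt y%:R :> R by rewrite sqrtr_gt0 ltr0n.
have hm : 0 < Num.sqrt m%:R :> R by rewrite sqrtr_gt0 ltr0n.
have cm : Num.sqrt y%:R <= Num.sqrt m%:R :> R by rewrite ler_wsqrtr // ler_nat.
apply: ler_wpM2l.
  by rewrite divr_ge0 // subr_ge0 ler_wsqrtr // ler_nat.
apply: lerB; last by rewrite lef_pV2.
by rewrite ler_wpM2r // invr_ge0 mulr_ge0 // ltW.
Qed.

(** With [a], [b], [c] the square roots of [d], [d.+1], [m], the gap between the two sides is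
    [(b - a)^2 (c^2 + a^2) / (4 c b)], which is positive. *)
Lemma ag_step_defect (R : realType) (d m : nat) : (0 < d)%N -> (0 < m)%N ->
  ag_step R d m *+ d <
  2^-1 * ((m%:R - d.+1%:R + 1) / (2 * Num.sqrt m%:R * Num.sqrt d.+1%:R)).
Proof.
move=> d0 m0; rewrite ag_stepE // -[X in X < _]mulr_natr.
set a := Num.sqrt d%:R; set b := Num.sqrt d.+1%:R; set c := Num.sqrt m%:R.
have ha : 0 < a by rewrite sqrtr_gt0 ltr0n.
have hb : 0 < b by rewrite sqrtr_gt0 ltr0n.
have hc : 0 < c by rewrite sqrtr_gt0 ltr0n.
have ab : 0 < b - a by rewrite subr_gt0 ltr_sqrt ?ltr_nat ?ltr0n.
have da : d%:R = a ^+ 2 by rewrite sqr_sqrtr ?ler0n.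
have mc : m%:R = c ^+ 2 by rewrite sqr_sqrtr ?ler0n.
(* This is [d.+1 - d = 1]; multiplying the numerator by it makes the gap an identity of rational
   functions in [a], [b], [c]. *)
have db : 1 = (b - a) * (b + a).
  by rewrite -subr_sqr !sqr_sqrtr ?ler0n // -natrB ?subSnn.
have -> : m%:R - d.+1%:R + 1 = (b - a) * (b + a) * (c ^+ 2 - a ^+ 2).
  by rewrite -db mul1r -mc -da -natr1; ring.
rewrite da -subr_gt0.
have -> : 2^-1 * ((b - a) * (b + a) * (c ^+ 2 - a ^+ 2) / (2 * c * b)) -
   (b - a) / 2 * (c / (a * b) - c^-1) * a ^+ 2 =
   (b - a) ^+ 2 * (c ^+ 2 + a ^+ 2) / (4 * c * b).
  by field; rewrite !gt_eqF.
by rewrite divr_gt0 ?(mulr_gt0, exprn_gt0) // addr_gt0 ?exprn_gt0.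
Qed.

(** * Sums over edges and neighbourhoods *)

Section Graph.
Variables (R : realType) (G : sgraph).
Implicit Types (u v w : G) (f : {set G}).

Lemma adj_neq u v : adj u v -> u != v.
Proof. by move=> uv; apply/eqP => E; rewrite E adj_irrefl in uv. Qed.

Lemma deg_gt0 u v : adj u v -> (0 < deg v)%N.
Proof. by move=> uv; apply/card_gt0P; exists u; rewrite inE adj_sym. Qed.

Lemma mem_edges u v : ([set u; v] \in edges G) = adj u v.
Proof.
apply/imsetP/idP => [[[x y]]|uv]; last by exists (u, v); rewrite ?inE.
rewrite inE /= => xy E.
have xE : x \in [set u; v] by rewrite E set21.
have yE : y \in [set u; v] by rewrite E set22.
have nxy := adj_neq xy.
move: xE yE xy nxy; rewrite !inE => /orP[]/eqP-> /orP[]/eqP->; rewrite ?eqxx //.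
by rewrite adj_sym.
Qed.

Lemma edgesP f :
  reflect (exists u v, adj u v /\ f = [set u; v]) (f \in edges G).
Proof.
apply: (iffP idP) => [/imsetP[[u v]]|[u [v [uv ->]]]]; last by rewrite mem_edges.
by rewrite inE /= => uv ->; exists u, v.
Qed.

Lemma edge_eq_pair f u v : u != v ->
  [&& f \in edges G, u \in f & v \in f :\ u] = adj u v && (f == [set u; v]).
Proof.
move=> nuv; apply/and3P/andP => [[/edgesP[x [y [xy ->]]]]|[uv /eqP->]].
  have nxy := adj_neq xy; rewrite !inE.
  case/orP=> /eqP-> /andP[]; rewrite ?eqxx.
    by move=> /negPf-> /= /eqP->; rewrite eqxx.
  by move=> /negPf->; rewrite orbF => /eqP->; rewrite adj_sym setUC eqxx.
by rewrite mem_edges uv !inE !eqxx orbT andbT (eq_sym v).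
Qed.

(** After exchanging the sums, each ordered pair of distinct vertices lies in exactly one edge if
    adjacent and in none otherwise, by [edge_eq_pair]. *)
Lemma sum_edges_ordered (t : G -> G -> R) :
  \sum_(f in edges G) \sum_(u in f) \sum_(v in f :\ u) t u v =
  \sum_u \sum_(v in nbhd u) t u v.
Proof.
rewrite (exchange_big_dep predT) //=; apply: eq_bigr => u _.
rewrite (exchange_big_dep predT) //= [RHS]big_mkcond.
apply: eq_bigr => v _; rewrite inE.
have [<-|nuv] := eqVneq u v.
  by rewrite adj_irrefl big1 // => f; rewrite !inE eqxx andbF.
under eq_bigl => f do rewrite -andbA edge_eq_pair //.
by case: (adj u v); rewrite ?big_pred0_eq //= big_pred1_eq.
Qed.

Lemma sum_ordered_pair (t : G -> G -> R) u v : u != v ->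
  \sum_(x in [set u; v]) \sum_(y in [set u; v] :\ x) t x y = t u v + t v u.
Proof.
move=> nuv; rewrite big_setU1 ?inE //= big_set1; congr (_ + _).
  by rewrite setU1K ?inE // big_set1.
by rewrite setUC setU1K ?inE 1?eq_sym // big_set1.
Qed.

Lemma dmax_gt0 v w : adj v w -> (2 <= deg v)%N -> (0 < dmax v w)%N.
Proof.
move=> vw; rewrite /deg (cardsD1 w) inE vw add1n ltnS => /card_gt0P[k hk].
have vk : adj v k by move: hk; rewrite !inE => /andP[].
by apply: leq_trans (deg_gt0 vk) _; apply: leq_bigmax_cond.
Qed.

Lemma deg_nbhdD1 v w : adj v w -> #|nbhd v :\ w| = (deg v).-1.
Proof. by move=> vw; rewrite /deg (cardsD1 w (nbhd v)) inE vw add1n. Qed.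

Lemma sum_ag_step_lt v w : adj v w -> (2 <= deg v)%N ->
  \sum_(k in nbhd v :\ w) ag_step R (deg v).-1 (deg k) <
  2^-1 * deg_defect R v w.
Proof.
move=> vw dv; have M0 := dmax_gt0 vw dv.
have d0 : (0 < (deg v).-1)%N by rewrite -ltnS prednK // ltnW.
have dE : (deg v).-1.+1 = deg v by rewrite prednK // ltnW.
rewrite /deg_defect /pendent gtn_eqF //.
apply: (@le_lt_trans _ _ (ag_step R (deg v).-1 (dmax v w) *+ (deg v).-1)).
  rewrite -[X in _ *+ X](deg_nbhdD1 vw) -sumr_const; apply: ler_sum => k hk.
  have vk : adj v k by move: hk; rewrite !inE => /andP[].
  by apply: ag_step_le => //; [exact: deg_gt0 vk | exact: leq_bigmax_cond].
by have := ag_step_defect R d0 M0; rewrite dE.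
Qed.

(** Strictness is lost only at a pendent [v], where the sum is empty and the defect is 0 by
    convention. *)
Lemma sum_ag_step_le v w : adj v w ->
  \sum_(k in nbhd v :\ w) ag_step R (deg v).-1 (deg k) <=
  2^-1 * deg_defect R v w.
Proof.
move=> vw; have [dv|dv] := leqP 2 (deg v); first exact/ltW/sum_ag_step_lt.
have d1 : deg v = 1%N.
  by apply/eqP; rewrite eqn_leq -ltnS dv /= (@deg_gt0 w) // adj_sym.
have /eqP := deg_nbhdD1 vw; rewrite d1 cards_eq0 => /eqP->.
by rewrite big_set0 /deg_defect /pendent d1 eqxx mulr0.
Qed.

Lemma deg_defect_le0 v w : adj v w ->
  (1%:E < deg_ratio R v w)%E -> deg_defect R v w <= 0.
Proof.
move=> vw; rewrite /deg_ratio /deg_defect /pendent.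
case: eqP => // /eqP dv1.
have dv : (2 <= deg v)%N.
  by rewrite ltn_neqAle eq_sym dv1 (@deg_gt0 w) // adj_sym.
rewrite lte_fin ltr_pdivlMr ?ltr0n ?dmax_gt0 // mul1r ltr_nat => lt.
rewrite mulr_le0_ge0 ?invr_ge0 ?mulr_ge0 ?sqrtr_ge0 //.
by rewrite addrAC natr1 subr_le0 ler_nat.
Qed.

End Graph.

(** * Effect of deleting the edge *)

Section Deletion.
Variables (R : realType) (G : sgraph) (i j : G).
Hypothesis ij : adj i j.

Local Notation e := [set i; j].
Local Notation G' := (del_edge e).

Lemma edges_del : edges G' = edges G :\ e :> {set {set G}}.
Proof.
apply/setP => f; rewrite in_setD1.
apply/(@edgesP G')/andP => [[u [v [/andP[uv nuv] ->]]]|[nfe /edgesP[u [v [uv E]]]]].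
  by rewrite nuv mem_edges.
by exists u, v; rewrite /= /del_adj uv -E nfe.
Qed.

Lemma nbhd_del_l : nbhd (i : G') = nbhd i :\ j :> {set G}.
Proof.
apply/setP => k; rewrite !inE /= /del_adj andbC.
have [ik|] := boolP (adj i k); last by rewrite !andbF.
congr (~~ _ && _); apply/eqP/eqP => [E|->] //.
have : k \in e by rewrite -E set22.
by rewrite !inE eq_sym (negPf (adj_neq ik)) => /eqP.
Qed.

Lemma deg_del_l : deg (i : G') = (deg i).-1.
Proof. by rewrite -(deg_nbhdD1 ij) -nbhd_del_l. Qed.

Lemma deg_del_other (k : G) : k \notin e -> deg (k : G') = deg k.
Proof.
move=> ke; rewrite /deg; apply: eq_card => u.
rewrite !inE /= /del_adj; case: eqP => [E|]; last by rewrite andbT.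
by rewrite -E set21 in ke.
Qed.

End Deletion.

Lemma nbhd_del_r (G : sgraph) (i j : G) :
  nbhd (j : del_edge [set i; j]) = nbhd j :\ i :> {set G}.
Proof. by rewrite setUC; exact: nbhd_del_l. Qed.

Lemma deg_del_r (G : sgraph) (i j : G) : adj i j ->
  deg (j : del_edge [set i; j]) = (deg j).-1.
Proof. by rewrite adj_sym setUC; exact: deg_del_l. Qed.

(** The change in each surviving edge is written as a sum over its two orientations, so that
    [sum_edges_ordered] regroups the total change by vertex, and only [i] and [j] contribute. *)
Lemma AG_del_edge (R : realType) (G : sgraph) (i j : G) : adj i j ->
  AG R (del_edge [set i; j]) =
  AG R G - ag_mean R (deg i) (deg j)
  + (\sum_(k in nbhd i :\ j) ag_step R (deg i).-1 (deg k)
     + \sum_(k in nbhd j :\ i) ag_step R (deg j).-1 (deg k)).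
Proof.
move=> ij; set e := [set i; j].
have eE : e \in edges G by rewrite mem_edges.
(* [t u v] is the part of the change on the edge [uv] caused by [u] losing a neighbour. *)
pose t (u v : G) : R := if u \in e then ag_step R (deg u).-1 (deg v) else 0.
have step (u v : G) : adj u v -> [set u; v] != e ->
    ag_mean R (deg (u : del_edge e)) (deg (v : del_edge e)) =
    ag_mean R (deg u) (deg v) + (t u v + t v u).
  have pos (x y : G) : adj x y -> x \in e -> y \notin e ->
    ag_mean R (deg (x : del_edge e)) (deg (y : del_edge e)) =
    ag_mean R (deg x) (deg y) + t x y.
    move=> xy xe ye; rewrite (deg_del_other ye) /t xe.
    have -> : deg (x : del_edge e) = (deg x).-1.
      by move: xe; rewrite !inE => /orP[]/eqP->; [exact: deg_del_l|exact: deg_del_r].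
    rewrite /ag_step prednK ?subrKC // (@deg_gt0 G y) // adj_sym //.
  move=> uv nuv; have [ue|ue] := boolP (u \in e); have [ve|ve] := boolP (v \in e).
  (* An edge with both ends in [e] is [e] itself, so a surviving edge has at most one end whose
     degree changes. *)
  - case/eqP: nuv; apply/eqP; rewrite eqEcard !cards2.
    rewrite (adj_neq uv) (adj_neq ij) leqnn andbT.
    by apply/subsetP => x; rewrite !inE => /orP[]/eqP->; rewrite -?in_set2.
  - by rewrite pos // {3}/t (negPf ve) addr0.
  - by rewrite ag_meanC pos // 1?adj_sym // {2}/t (negPf ue) add0r ag_meanC.
  - by rewrite !deg_del_other // /t (negPf ue) (negPf ve) !addr0.
rewrite /AG [in RHS](bigD1 e) //= AG_weightE // -/(ag_mean R _ _).
rewrite [X in X - _]addrC addrK.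
have -> : \sum_(f in edges (del_edge e)) AG_weight R f =
  \sum_(f in edges (del_edge e)) (@AG_weight R G f
    + \sum_(u in f) \sum_(v in f :\ u) t u v).
  apply: eq_bigr => f /edgesP[u [v [uv' ->]]].
  have /andP[uv nuv] := uv'.
  rewrite (AG_weightE _ uv') (@AG_weightE R G u v uv).
  by rewrite -!/(ag_mean R _ _) sum_ordered_pair ?adj_neq // step.
rewrite big_split; congr (_ + _).
  by apply: eq_bigl => f; rewrite edges_del in_setD1 andbC.
(* Regrouping takes place in the deleted graph, whose neighbourhoods of [i] and [j] already omit the
   other endpoint. *)
rewrite (@sum_edges_ordered R (del_edge e)).
rewrite (bigID (mem e)) /= [X in _ + X]big1 ?addr0; last first.
  by move=> u ue; apply: big1 => v _; rewrite /t (negPf ue).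
rewrite big_setU1 ?inE ?adj_neq //= big_set1 nbhd_del_l nbhd_del_r.
by congr (_ + _); apply: eq_bigr => k _; rewrite /t ?set21 ?set22.
Qed.

Theorem theorem14 (R : realType) (G : sgraph) (i j : G)
  (ij_edge : adj i j)
  (j_nonpendent : (2 <= deg j)%N)
  (hyp : (1%:E < Order.min (deg_ratio R i j) (deg_ratio R j i))%E \/
         deg_defect R i j + deg_defect R j i <=
           ((deg i)%:R + (deg j)%:R) / Num.sqrt ((deg i)%:R * (deg j)%:R)) :
  AG R G > AG R (del_edge [set i; j]).
Proof.
have ji : adj j i by rewrite adj_sym.
have {}hyp : deg_defect R i j + deg_defect R j i <=
    ((deg i)%:R + (deg j)%:R) / Num.sqrt ((deg i)%:R * (deg j)%:R).
  case: hyp => //; rewrite lt_min => /andP[hi hj].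
  apply: (@le_trans _ _ 0); last by rewrite divr_ge0 ?addr_ge0 ?sqrtr_ge0.
  have := deg_defect_le0 ij_edge hi.
  have := deg_defect_le0 ji hj; lra.
rewrite AG_del_edge // ag_mean_half ?(deg_gt0 ij_edge) ?(deg_gt0 ji) //.
(* The bound at [i] is weak, since [i] may be pendent; the strict inequality comes from [j]. Half of
   (ii) then closes the goal. *)
have := sum_ag_step_le R ij_edge.
have := sum_ag_step_lt R ji j_nonpendent.
lra.
Qed.
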